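(* Consider a group of $n\ge 2$ unicycles without overlap. A circular formation is realized if and only if the following conditions hold: $$\tilde z_j\times\tilde{\mathtt r}_j=0\quad\text{for all } j\in\{2,3,\ldots,n\},$$ $$\frac{\tilde z_2^\top\tilde{\mathtt r}_2}{\|\tilde{\mathtt r}_2\|^2}-\frac{\tilde z_j^\top\tilde{\mathtt r}_j}{\|\tilde{\mathtt r}_j\|^2}=0\quad\text{for all } j\in\{3,4,\ldots,n\},$$ where $\|\tilde z_j\|$ and $\|\tilde{\mathtt r}_j\|$ are nonzero for all $j\in\{2,3,\ldots,n\}$. Moreover, the submanifold of the space $\mathbb R^{3n}$ of global coordinates $(x_i,y_i,\theta_i)_{i=1}^n$ induced by these equations has dimension $n+3$.
   Context: Each unicycle $i\in\{1,\ldots,n\}$ has position $z_i=[x_i,y_i]^\top\in\mathbb R^2$ and heading $\theta_i\in\mathbb R$, and moves according to $\dot x_i=v\cos\theta_i$, $\dot y_i=v\sin\theta_i$, $\dot\theta_i=\omega_i$, where $v>0$ is a fixed common forward speed. ''Without overlap'' means $z_i\ne z_j$ for $i\neq j$. For $j\in\{2,\ldots,n\}$ set $\tilde z_j=z_1-z_j$, $\tilde{\mathtt r}_j=\mathtt r_1-\mathtt r_j$, where $\mathtt r_i=[-\sin\theta_i,\cos\theta_i]^\top$. $\|\cdot\|$ is the Euclidean norm and $\times$ is the planar (scalar) cross product. Circular formation: the unicycles travel along a common circle at the same angular speed. At the level of positions and headings this means that there is a circle (of finite positive radius) containing all positions $z_i$, such that each heading vector $[\cos\theta_i,\sin\theta_i]^\top$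 is tangent to the circle at $z_i$ and all headings point in the same rotation direction (all counterclockwise or all clockwise), so that, at the common forward speed $v$, all travel along it at the same angular speed. *)

(* Defs.v *)
From HB Require Import structures.
From mathcomp Require Import all_boot all_order all_algebra.
From mathcomp Require Import all_classical all_reals all_analysis.

Set Implicit Arguments.
Unset Strict Implicit.
Unset Printing Implicit Defensive.

Import Order.TTheory GRing.Theory Num.Theory.
Import numFieldNormedType.Exports.

Local Open Scope classical_set_scope.
Local Open Scope ring_scope.

Section Plane.
Variable R : realType.
Implicit Types u v : 'cV[R]_2.

Definition vec2 (a b : R) : 'cV[R]_2 := \col_k (if k == 0 then a else b).

Definition dot u v : R := (u^T *m v) 0 0.

Definition cross u v : R := u 0 0 * v 1 0 - u 1 0 * v 0 0.

(* The library norm `|u| on matrices is the sup norm. *)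
Definition enorm u : R := Num.sqrt (dot u u).

End Plane.

(* Configurations of n unicycles are points q of R^(3n), written as n x 3
   matrices whose row i is (x_i, y_i, theta_i).  Indices start at 0. *)
Section Unicycles.
Variables (R : realType) (n : nat).
Implicit Types (q : 'M[R]_(n, 3)) (i j : 'I_n).

Definition pos q i : 'cV[R]_2 := vec2 (q i 0) (q i 1).

Definition theta q i : R := q i 2.

Definition heading q i : 'cV[R]_2 := vec2 (cos (theta q i)) (sin (theta q i)).

Definition rvec q i : 'cV[R]_2 := vec2 (- sin (theta q i)) (cos (theta q i)).

Definition no_overlap q : Prop := forall i j, i != j -> pos q i != pos q j.

(* The sign of (z_i - c) x heading_i is the direction of rotation about c:
   positive for counterclockwise, negative for clockwise. *)
Definition circular_formation q : Prop :=
  exists (c : 'cV[R]_2) (rho : R),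
    [/\ 0 < rho,
        forall i, enorm (pos q i - c) = rho,
        forall i, dot (pos q i - c) (heading q i) = 0 &
        (forall i, 0 < cross (pos q i - c) (heading q i)) \/
        (forall i, cross (pos q i - c) (heading q i) < 0)].

Section Equations.
Hypothesis hn : (2 <= n)%N.

Definition uni1 : 'I_n := Ordinal (ltnW hn).
Definition uni2 : 'I_n := Ordinal hn.

Definition ztilde q j : 'cV[R]_2 := pos q uni1 - pos q j.

Definition rtilde q j : 'cV[R]_2 := rvec q uni1 - rvec q j.

Definition formation_ratio q j : R :=
  dot (ztilde q j) (rtilde q j) / enorm (rtilde q j) ^+ 2.

Definition formation_equations q : Prop :=
  [/\ forall j, (1 <= j)%N -> enorm (ztilde q j) != 0 /\ enorm (rtilde q j) != 0,
      forall j, (1 <= j)%N -> cross (ztilde q j) (rtilde q j) = 0 &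
      forall j, (2 <= j)%N -> formation_ratio q uni2 - formation_ratio q j = 0].

End Equations.
End Unicycles.

Section Submanifolds.
Variable R : realType.

(* f is of class C^k on the open set U.  On finite-dimensional spaces, a
   differentiable map is C^(k+1) iff all its directional derivatives are C^k. *)
Fixpoint Ck_on (V W : normedModType R) (k : nat) (U : set V) (f : V -> W) :
    Prop :=
  match k with
  | 0%N => forall x, U x -> {for x, continuous f}
  | k'.+1 => (forall x, U x -> differentiable f x) /\
             (forall v : V, Ck_on k' U (fun x => 'D_v f x))
  end.

Definition smooth_on (V W : normedModType R) (U : set V) (f : V -> W) : Prop :=
  forall k, Ck_on k U f.

(* phi : U -> V and psi : V -> U are mutually inverse smooth maps; their values
   outside U and V are irrelevant. *)
Definition diffeomorphism (E F : normedModType R) (U : set E) (V : set F)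
    (phi : E -> F) (psi : F -> E) : Prop :=
  [/\ open U /\ open V,
      (forall x, U x -> V (phi x)) /\ (forall y, V y -> U (psi y)),
      (forall x, U x -> psi (phi x) = x) /\ (forall y, V y -> phi (psi y) = y) &
      smooth_on U phi /\ smooth_on V psi].

(* S is an embedded smooth d-dimensional submanifold of the N-dimensional space
   E: around each point of S some chart of E onto an open subset of R^N
   straightens S to the slice where all coordinates of index >= d vanish.
   S is required to be nonempty so that its dimension is determined. *)
Definition submanifold_of_dim (E : normedModType R) (N d : nat) (S : set E) :
    Prop :=
  [/\ (d <= N)%N, S !=set0 &
      forall p, S p ->
        exists (U : set E) (V : set 'rV[R]_N)
               (phi : E -> 'rV[R]_N) (psi : 'rV[R]_N -> E),
          [/\ U p, diffeomorphism U V phi psi &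
              forall x, U x ->
                (S x <-> forall k : 'I_N, (d <= k)%N -> phi x 0 k = 0)]].

End Submanifolds.

(* Main.v *)
Require Import Defs.
From HB Require Import structures.
From mathcomp Require Import all_boot all_order all_algebra.
From mathcomp Require Import all_classical all_reals all_analysis.
From mathcomp Require Import ring zify.
Import Order.TTheory GRing.Theory Num.Theory.
Import numFieldNormedType.Exports.
Local Open Scope classical_set_scope.
Local Open Scope ring_scope.

Set Implicit Arguments.
Unset Strict Implicit.
Unset Printing Implicit Defensive.

(* Both conditions say that z_i = c + lam r_i for all i, with one centre c and
   one signed radius lam <> 0 (lam < 0 for counterclockwise motion): r_i is the
   unit normal to the heading, and the formation equations express that
   z_1 - z_j = lam (r_1 - r_j) with lam independent of j.
   A solution is thus determined by the n headings, c and lam.  These n + 3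
   functions, with lam := <z_1 - z_2, r_1 - r_2> / |r_1 - r_2|^2 and
   c := z_1 - lam r_1, are completed to coordinates of R^(3n) by the component
   of z_1 - z_2 orthogonal to r_1 - r_2 and the residuals z_j - c - lam r_j for
   j >= 3.  The inverse of this chart is polynomial in the coordinates and the
   sines and cosines of the headings, and the solutions are the common zeros of
   the 2n - 3 added coordinates. *)

(** * Smooth maps *)

(** Differentiability at a point depends only on the germ there: the expansion of [f] is also one of
    [g], and uniqueness of the differential makes ['d f x] the differential of [g]. *)
Lemma near_eq_differentiable (R : numFieldType) (V W : normedModType R)
    (f g : V -> W) (x : V) :
  {near x, f =1 g} -> differentiable f x -> differentiable g x.
Proof.
move=> fg /diff_locallyP[dfc dfe].
have gx : g x = f x by rewrite (nbhs_singleton fg).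
have ge : g \o shift x = cst (g x) + 'd f x +o_ 0 id.
  apply/eqaddoP => e e0.
  have fg0 : \forall h \near (0 : V), f (h + x) = g (h + x).
    by move: fg; rewrite (near_shift 0) subr0.
  have /eqaddoP /(_ e e0) := dfe; apply: filterS2 fg0 => h /= fgh.
  by rewrite !fctE /= -fgh gx.
have dg : 'd g x = 'd f x :> (V -> W) by exact: diff_unique.
by apply/diff_locallyP; rewrite dg.
Qed.

Section SmoothMaps.
Variable R : realType.

Section Basics.
Variables (V W : normedModType R) (U : set V).
Hypothesis openU : open U.
Implicit Types f g : V -> W.

(** As [U] is open, agreement on [U] is agreement near each of its points, which limits and
    derivatives respect. The closure lemmas below use this to replace a directional derivative by
    its formula, valid on [U] only. *)
Lemma Ck_on_ext k f g : (forall x, U x -> f x = g x) ->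
  Ck_on k U f -> Ck_on k U g.
Proof.
elim: k f g => [|k IH] f g fg /=.
  move=> cf x Ux; change (g @ x --> g x); rewrite -fg //.
  apply: cvg_trans (cf x Ux); apply: near_eq_cvg.
  by near=> y; apply: fg; near: y; exact: open_nbhs_nbhs.
move=> [df Df]; split=> [x Ux|v].
  apply: near_eq_differentiable (df x Ux).
  by near=> y; apply: fg; near: y; exact: open_nbhs_nbhs.
apply: IH (Df v) => x Ux; apply: near_eq_derive.
by near=> y; apply: fg; near: y; exact: open_nbhs_nbhs.
Unshelve. all: by end_near. Qed.

Lemma Ck_onW k f : Ck_on k.+1 U f -> Ck_on k U f.
Proof.
elim: k f => [|k IH] f.
  by move=> [df _] x Ux; exact/differentiable_continuous/df.
by move=> [df Df]; split=> // v; exact/IH/Df.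
Qed.

Lemma Ck_on_cst k (c : W) : Ck_on k U (cst c).
Proof.
elim: k c => [|k IH] c /=; first by move=> x _; exact: cvg_cst.
split=> [x _|v]; first exact: differentiable_cst.
by apply: Ck_on_ext (IH 0) => x _; rewrite derive_cst.
Qed.

Lemma Ck_onD k f g :
  Ck_on k U f -> Ck_on k U g -> Ck_on k U (fun x => f x + g x).
Proof.
elim: k f g => [|k IH] f g /=.
  by move=> cf cg x Ux; apply: cvgD; [exact: cf|exact: cg].
move=> [df Df] [dg Dg]; split=> [x Ux|v].
  by apply: differentiableD; [exact: df|exact: dg].
apply: Ck_on_ext (IH _ _ (Df v) (Dg v)) => x Ux.
by rewrite deriveD//; apply: diff_derivable; [exact: df|exact: dg].
Qed.

Lemma Ck_on_linear k (f : {linear V -> W}) : continuous f -> Ck_on k U f.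
Proof.
move=> cf; case: k => [|k]; first by move=> x _; exact: cf.
split=> [x _|v]; first exact: linear_differentiable.
apply: Ck_on_ext (Ck_on_cst k (f v)) => x _.
by rewrite deriveE ?diff_lin//; exact: linear_differentiable.
Qed.

Lemma Ck_onZl k (f : V -> R) (w : W) :
  Ck_on k U f -> Ck_on k U (fun x => f x *: w).
Proof.
elim: k f => [|k IH] f.
  by move=> cf x Ux; apply: cvgZr_tmp; exact: cf.
move=> [df Df]; split=> [x Ux|v].
  by apply: differentiableZl; exact: df.
apply: Ck_on_ext (IH _ (Df v)) => x Ux.
by rewrite !deriveE ?diffZl//; [exact: df|apply: differentiableZl|]; exact: df.
Qed.

Lemma Ck_on_sum k n (F : 'I_n -> V -> W) :
  (forall i, Ck_on k U (F i)) -> Ck_on k U (fun x => \sum_(i < n) F i x).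
Proof.
move=> CF; rewrite (_ : (fun x => _) = \sum_(i < n) F i); last first.
  by apply/funext => x; rewrite fct_sumE.
by elim/big_ind : _ => // [|f g]; [exact: Ck_on_cst|exact: Ck_onD].
Qed.

End Basics.

Section ScalarFunctions.
Variables (V : normedModType R) (U : set V).
Hypothesis openU : open U.
Implicit Types f g : V -> R.

(** Leibniz rule: the derivative pairs one factor with the derivative of the other, so the induction
    runs over all pairs and lowers the order of the undifferentiated factor by [Ck_onW]. *)
Lemma Ck_onM k f g :
  Ck_on k U f -> Ck_on k U g -> Ck_on k U (fun x => f x * g x).
Proof.
elim: k f g => [|k IH] f g.
  by move=> cf cg x Ux; apply: cvgM; [exact: cf|exact: cg].
move=> Cf Cg; have [df Df] := Cf; have [dg Dg] := Cg; split=> [x Ux|v].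
  by apply: differentiableM; [exact: df|exact: dg].
apply: (@Ck_on_ext _ _ _ openU _ (fun x => f x * 'D_v g x + g x * 'D_v f x)).
  move=> x Ux; rewrite deriveM//; apply: diff_derivable; [exact: df|exact: dg].
by apply: Ck_onD => //; apply: IH; try exact: Ck_onW; [exact: Dg|exact: Df].
Qed.

Lemma Ck_onN k f : Ck_on k U f -> Ck_on k U (fun x => - f x).
Proof.
move=> Cf.
apply: (Ck_on_ext openU _ (Ck_onM (Ck_on_cst openU k (- 1 : R)) Cf)) => x _.
by rewrite /= mulN1r.
Qed.

Lemma Ck_onV k f : (forall x, U x -> f x != 0) ->
  Ck_on k U f -> Ck_on k U (fun x => (f x)^-1).
Proof.
move=> f0; elim: k => [|k IH].
  by move=> cf x Ux; apply: cvgV; [exact: f0|exact: cf].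
move=> Cf; have [df Df] := Cf; split=> [x Ux|v].
  by apply: differentiableV; [exact: df|exact: f0].
apply: (@Ck_on_ext _ _ _ openU _ (fun x => - ((f x)^-1 * (f x)^-1 * 'D_v f x))).
  move=> x Ux; rewrite deriveV//; [|exact: f0|exact/diff_derivable/df].
  by rewrite expr2 invfM scaleNr.
apply: Ck_onN; apply: Ck_onM; last exact: Df.
by apply: Ck_onM; apply: IH; exact: Ck_onW.
Qed.

Lemma differentiable_comp1 (h : R -> R) f (x v : V) (h' : R) :
  is_derive (f x) 1 h h' -> differentiable f x ->
  differentiable (h \o f) x /\ 'D_v (h \o f) x = h' * 'D_v f x.
Proof.
move=> [hd hv] df.
have dh : differentiable h (f x) by exact/derivable1_diffP.
have dhf : differentiable (h \o f) x by exact: differentiable_comp.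
split=> //.
rewrite !deriveE// diff_comp//= deriv1E//.
by rewrite derive1E hv /= mulrC.
Qed.

(** Each function is up to sign the derivative of the other, hence a joint induction. *)
Lemma Ck_on_sin_cos k f : Ck_on k U f ->
  Ck_on k U (fun x => sin (f x)) /\ Ck_on k U (fun x => cos (f x)).
Proof.
elim: k => [|k IH].
  by move=> cf; split=> x Ux; apply: cvg_comp (cf x Ux) _;
    [exact: continuous_sin|exact: continuous_cos].
move=> Cf; have [df Df] := Cf; have [Cs Cc] := IH (Ck_onW Cf).
split; split=> [x Ux|v].
- by have [] := differentiable_comp1 0 (is_derive_sin (f x)) (df x Ux).
- apply: (Ck_on_ext openU _ (Ck_onM Cc (Df v))) => x Ux.
  by have [_ ->] := differentiable_comp1 v (is_derive_sin (f x)) (df x Ux).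
- by have [] := differentiable_comp1 0 (is_derive_cos (f x)) (df x Ux).
- apply: (Ck_on_ext openU _ (Ck_onM (Ck_onN Cs) (Df v))) => x Ux.
  by have [_ ->] := differentiable_comp1 v (is_derive_cos (f x)) (df x Ux).
Qed.

End ScalarFunctions.

Lemma Ck_on_coord m n (U : set 'M[R]_(m, n)) k (i : 'I_m) (j : 'I_n) :
  open U -> Ck_on k U (fun M : 'M[R]_(m, n) => M i j : R).
Proof.
move=> openU; pose f (M : 'M[R]_(m, n)) : R := M i j.
have f_linear : linear f by move=> a M N; rewrite /f !mxE.
pose lf : {linear 'M[R]_(m, n) -> R} :=
  HB.pack f (GRing.isLinear.Build _ _ _ _ f f_linear).
by apply: (@Ck_on_linear _ _ _ openU k lf); exact: coord_continuous.
Qed.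

(** Expansion in the basis [delta_mx i j] reduces a matrix-valued map to its entries. *)
Lemma Ck_on_matrix (V : normedModType R) (U : set V) m n k
    (F : V -> 'M[R]_(m, n)) : open U ->
  (forall i j, Ck_on k U (fun x => F x i j)) -> Ck_on k U F.
Proof.
move=> openU CF.
apply: (@Ck_on_ext _ _ _ openU _
  (fun x => \sum_i \sum_j F x i j *: delta_mx i j)).
  by move=> x _; rewrite -matrix_sum_delta.
by do 2!apply: Ck_on_sum => // ?; exact: Ck_onZl.
Qed.

End SmoothMaps.

(** * Formations as a common centre and signed radius *)

Section PlaneTheory.
Variable R : realType.
Implicit Types u v w : 'cV[R]_2.

Lemma cV2P u v : u 0 0 = v 0 0 -> u 1 0 = v 1 0 -> u = v.
Proof.
move=> e0 e1; apply/colP => -[[|[|//]] Hi].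
- by rewrite (_ : Ordinal Hi = 0) //; exact: val_inj.
- by rewrite (_ : Ordinal Hi = 1) //; exact: val_inj.
Qed.

Lemma vec20 (a b : R) : vec2 a b 0 0 = a. Proof. by rewrite mxE. Qed.
Lemma vec21 (a b : R) : vec2 a b 1 0 = b. Proof. by rewrite mxE. Qed.

Lemma dotE u v : dot u v = u 0 0 * v 0 0 + u 1 0 * v 1 0.
Proof.
rewrite /dot mxE !big_ord_recl big_ord0 addr0 !mxE.
by congr (_ + u _ _ * v _ _); exact: val_inj.
Qed.

Lemma dot_gt0 v : v != 0 -> 0 < dot v v.
Proof.
move=> v0; rewrite lt_neqAle dotE -!expr2 addr_ge0 ?sqr_ge0// andbT eq_sym.
apply: contra v0; rewrite paddr_eq0 ?sqr_ge0// !sqrf_eq0.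
by move=> /andP[/eqP v0 /eqP v1]; apply/eqP/cV2P; rewrite ?v0 ?v1 !mxE.
Qed.

Lemma dot_eq0 v : (dot v v == 0) = (v == 0).
Proof.
apply/eqP/eqP => [v0|->]; last by rewrite dotE !mxE !mul0r addr0.
by apply: contraPeq v0 => /dot_gt0 v0; apply/eqP; rewrite gt_eqF.
Qed.

Lemma sqr_enorm v : enorm v ^+ 2 = dot v v.
Proof. by rewrite sqr_sqrtr// dotE -!expr2 addr_ge0 ?sqr_ge0. Qed.

Lemma enorm_eq0 v : (enorm v == 0) = (v == 0).
Proof. by rewrite -sqrf_eq0 sqr_enorm dot_eq0. Qed.

(** Coefficient of the orthogonal projection of [u] onto the line of [v]; [formation_ratio] is an
    instance. *)
Definition coord_along v u : R := dot u v / enorm v ^+ 2.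

(** Clockwise quarter turn, with the sign for which [cross (rot_cw v) v] is the squared length of
    [v]. *)
Definition rot_cw v : 'cV[R]_2 := vec2 (v 1 0) (- v 0 0).

(** [v] and [rot_cw v] are orthogonal and of equal length, hence a basis. A vanishing cross product
    thus leaves only the multiple of [v]. The next two lemmas give uniqueness of the
    coefficients. *)
Lemma decompose_along u v : v != 0 ->
  u = coord_along v u *: v + (cross u v / enorm v ^+ 2) *: rot_cw v.
Proof.
move=> /dot_gt0 v0; rewrite /coord_along sqr_enorm; move/lt0r_neq0: v0.
rewrite !dotE /cross => v0.
by apply: cV2P; rewrite !mxE /=; field.
Qed.

Lemma coord_along_comb (a b : R) v : v != 0 ->
  coord_along v (a *: v + b *: rot_cw v) = a.
Proof.
move=> /dot_gt0 /lt0r_neq0; rewrite /coord_along sqr_enorm !dotE !mxE /= => v0.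
by field.
Qed.

Lemma cross_comb (a b : R) v : v != 0 ->
  cross (a *: v + b *: rot_cw v) v / enorm v ^+ 2 = b.
Proof.
move=> /dot_gt0 /lt0r_neq0; rewrite sqr_enorm dotE /cross !mxE /= => v0.
by field.
Qed.

(** The heading and its left normal form an orthonormal basis, and the coefficient of [u] on the
    normal is minus its cross product with the heading. *)
Lemma tangent_normal u (t : R) : dot u (vec2 (cos t) (sin t)) = 0 ->
  u = - cross u (vec2 (cos t) (sin t)) *: vec2 (- sin t) (cos t).
Proof.
rewrite dotE /cross !vec20 !vec21 => ut.
have cs := cos2Dsin2 t.
apply: cV2P; rewrite !mxE /=.
  transitivity (u 0 0 * (cos t ^+ 2 + sin t ^+ 2)
    - cos t * (u 0 0 * cos t + u 1 0 * sin t)); last by ring.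
  by rewrite ut cs mulr0 subr0 mulr1.
transitivity (u 1 0 * (cos t ^+ 2 + sin t ^+ 2)
    - sin t * (u 0 0 * cos t + u 1 0 * sin t)); last by ring.
by rewrite ut cs mulr0 subr0 mulr1.
Qed.

End PlaneTheory.

(** * Equivalence of circular formations and the formation equations *)

Section Formations.
Variables (R : realType) (n : nat) (hn : (2 <= n)%N).
Implicit Types (q : 'M[R]_(n, 3)) (i j : 'I_n).
Local Notation o1 := (uni1 hn).
Local Notation o2 := (uni2 hn).

(** The cross products make each [ztilde] equal to its [formation_ratio] times [rtilde], and the
    remaining equations make these ratios equal. The common value is nonzero because [ztilde] of
    [o2] is. *)
Lemma formation_equationsP q : formation_equations hn q <->
  exists2 lam : R, lam != 0 & forall j, (1 <= j)%N ->
    rtilde hn q j != 0 /\ ztilde hn q j = lam *: rtilde hn q j.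
Proof.
split=> [[nz cr ra]|[lam lam0 H]].
  have E j : (1 <= j)%N -> rtilde hn q j != 0 /\
      ztilde hn q j = formation_ratio hn q j *: rtilde hn q j.
    move=> j1; have [_] := nz j j1; rewrite enorm_eq0 => r0; split=> //.
    by rewrite {1}(decompose_along (ztilde hn q j) r0) cr// mul0r scale0r addr0.
  exists (formation_ratio hn q o2).
    apply/negP => /eqP l0; have [] := nz o2 isT.
    by have [_ ->] := E o2 isT; rewrite l0 scale0r enorm_eq0 eqxx.
  move=> j j1; have [r0 zE] := E j j1; split=> //.
  (* Indices start at 0, so [j = 1] is [o2] itself, whose ratio is the reference value. *)
  case: (ltngtP j 1%N) => [|j2|j2]; first by rewrite ltnNge j1.
    by rewrite zE; move/subr0_eq: (ra j j2) => ->.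
  by rewrite zE (_ : j = o2)//; exact: val_inj.
have E j : (1 <= j)%N -> formation_ratio hn q j = lam.
  move=> /H[r0 zE]; rewrite /formation_ratio zE.
  by rewrite -[RHS](coord_along_comb lam 0 r0) scale0r addr0.
split=> [j j1|j j1|j j2].
- by have [r0 ->] := H j j1; rewrite !enorm_eq0 scaler_eq0 negb_or lam0 r0.
- by have [_ ->] := H j j1; rewrite /cross !mxE; ring.
- by rewrite !E ?subrr//; exact: ltnW.
Qed.

(** Tangency makes [z_i - c] a multiple of the unit normal [r_i], so the coefficient has absolute
    value [rho]; the common orientation fixes its sign, the same for all [i]. Conversely the radius
    is the absolute value of [lam], and every cross product equals [- lam]. *)
Lemma circular_formationP q : circular_formation q <->
  exists (c : 'cV[R]_2) (lam : R),
    lam != 0 /\ forall i, pos q i = c + lam *: rvec q i.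
Proof.
split=> [[c [rho [rho0 nE tang orient]]]|[c [lam [lam0 pE]]]].
  have E i : pos q i - c = - cross (pos q i - c) (heading q i) *: rvec q i.
    exact: tangent_normal (tang i).
  have nr i : dot (rvec q i) (rvec q i) = 1.
    by rewrite dotE !vec20 !vec21 mulrNN -!expr2 addrC cos2Dsin2.
  have absE i : `|cross (pos q i - c) (heading q i)| = rho.
    rewrite -(nE i) {2}E /enorm; set a := cross _ _.
    rewrite (_ : dot _ _ = a ^+ 2 * dot (rvec q i) (rvec q i)).
      by rewrite nr mulr1 sqrtr_sqr.
    by rewrite !dotE !mxE; ring.
  (* Counterclockwise motion gives [lam = - rho], clockwise motion gives [lam = rho]. *)
  case: orient => orient.
    exists c, (- rho); split; first by rewrite oppr_eq0 gt_eqF.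
    by move=> i; rewrite -(absE i) gtr0_norm// -E subrKC.
  exists c, rho; split; first by rewrite gt_eqF.
  by move=> i; rewrite -(absE i) ltr0_norm// -E subrKC.
have cs i := cos2Dsin2 (theta q i).
exists c, `|lam|; split; first by rewrite normr_gt0.
- move=> i; rewrite pE addrAC subrr add0r /enorm.
  rewrite (_ : dot _ _ = lam ^+ 2); first by rewrite sqrtr_sqr.
  rewrite -[RHS]mulr1 -(cs i) dotE !mxE /=; ring.
- by move=> i; rewrite pE addrAC subrr add0r dotE !mxE /=; ring.
- have crE i : cross (pos q i - c) (heading q i) = - lam.
    rewrite pE addrAC subrr add0r /cross !mxE /=.
    by rewrite -[RHS]mulr1 -(cs i); ring.
  case: (ltrgtP lam 0) lam0 => [l0 _|l0 _|//].
    by left=> i; rewrite crE oppr_gt0.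
  by right=> i; rewrite crE oppr_lt0.
Qed.

(** Subtracting the relations of unicycles 1 and [j] eliminates the centre; conversely the relation
    of unicycle 1 defines it. Equal normals would give equal positions, so the absence of overlap
    yields [rtilde] nonzero. *)
Lemma circular_formation_iff q : no_overlap q ->
  (circular_formation q <-> formation_equations hn q).
Proof.
move=> no; rewrite circular_formationP formation_equationsP.
split=> [[c [lam [lam0 pE]]]|[lam lam0 H]].
  exists lam => // j j1.
  have zE : ztilde hn q j = lam *: rtilde hn q j.
    by rewrite /ztilde /rtilde !pE opprD addrACA subrr add0r scalerBr.
  split=> //; apply/negP => /eqP r0.
  have : o1 != j by rewrite -val_eqE /= eq_sym -lt0n.
  by move=> /no; rewrite -subr_eq0 -/(ztilde hn q j) zE r0 scaler0 eqxx.
exists (pos q o1 - lam *: rvec q o1), lam; split=> // i.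
case: (posnP i) => [i0|/H[_]].
  by rewrite (_ : i = o1) ?subrK//; exact: val_inj.
rewrite /ztilde /rtilde scalerBr => zE.
by rewrite -[LHS](subKr (pos q o1)) zE opprB addrA addrAC.
Qed.

End Formations.

(** * A straightening chart *)

Section Chart.
Variables (R : realType) (n : nat) (hn : (2 <= n)%N).
Implicit Types (q : 'M[R]_(n, 3)) (y : 'rV[R]_(3 * n)) (i j : 'I_n).
Local Notation o1 := (uni1 hn).
Local Notation o2 := (uni2 hn).

Fact angle_index_subproof i : (i < 3 * n)%N.
Proof. by clear hn; have := ltn_ord i; lia. Qed.
Definition angle_index i : 'I_(3 * n) := Ordinal (angle_index_subproof i).

Fact plane_index_subproof i (b : bool) : (n + 2 * i + b < 3 * n)%N.
Proof. by clear hn; have := ltn_ord i; case: b; lia. Qed.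
Definition plane_index i (b : bool) : 'I_(3 * n) :=
  Ordinal (plane_index_subproof i b).

Definition plane_coord y i : 'cV[R]_2 :=
  vec2 (y 0 (plane_index i false)) (y 0 (plane_index i true)).

(** Inverse of the two index maps above. The default [o1] is never reached: [k < n] in one branch,
    and [(k - n)./2 < n] in the other since [k < 3 * n]. *)
Definition chart_index_of (k : 'I_(3 * n)) : 'I_n + 'I_n * bool :=
  if (k < n)%N then inl (insubd o1 (k : nat))
  else inr (insubd o1 (k - n)./2, odd (k - n)).

Lemma chart_index_angle i : chart_index_of (angle_index i) = inl i.
Proof.
rewrite /chart_index_of /= ltn_ord; congr inl.
by apply: val_inj; rewrite val_insubd ltn_ord.
Qed.

Lemma chart_index_plane i b : chart_index_of (plane_index i b) = inr (i, b).
Proof.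
rewrite /chart_index_of /= ltnNge -addnA leq_addr /= addKn.
congr (inr (_, _)); last by rewrite oddD mul2n odd_double; case: b.
apply: val_inj; rewrite val_insubd addnC mul2n half_bit_double.
by rewrite ltn_ord.
Qed.

Variant chart_index_spec : 'I_(3 * n) -> Type :=
  | AngleIndex i : chart_index_spec (angle_index i)
  | PlaneIndex i b : chart_index_spec (plane_index i b).

Lemma chart_indexP k : chart_index_spec k.
Proof.
have kn := ltn_ord k; case: (ltnP k n) => [kn'|nk].
  by rewrite (_ : k = angle_index (Ordinal kn')); [left|exact: val_inj].
have H : ((k - n)./2 < n)%N by lia.
rewrite (_ : k = plane_index (Ordinal H) (odd (k - n))); first by right.
by apply: val_inj => /=; lia.
Qed.

Lemma chart_coordsP y y' :
  (forall i, y 0 (angle_index i) = y' 0 (angle_index i)) ->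
  (forall i, plane_coord y i = plane_coord y' i) -> y = y'.
Proof.
move=> ya yp; apply/rowP => k; case: (chart_indexP k) => [//|i b].
move/matrixP: (yp i) => E.
by case: b; [move: (E 1 0)|move: (E 0 0)]; rewrite !mxE.
Qed.

Lemma configurationP q q' :
  (forall i, theta q i = theta q' i) -> (forall i, pos q i = pos q' i) ->
  q = q'.
Proof.
move=> th po; apply/matrixP => i -[[|[|[|//]]] H].
- rewrite (_ : Ordinal H = 0); last exact: val_inj.
  by move/matrixP: (po i) => /(_ 0 0); rewrite !mxE.
- rewrite (_ : Ordinal H = 1); last exact: val_inj.
  by move/matrixP: (po i) => /(_ 1 0); rewrite !mxE.
- by rewrite (_ : Ordinal H = 2); [exact: th|exact: val_inj].
Qed.

Definition signed_radius q : R := coord_along (rtilde hn q o2) (ztilde hn q o2).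

Definition transverse q : R :=
  cross (ztilde hn q o2) (rtilde hn q o2) / enorm (rtilde hn q o2) ^+ 2.

Definition rotation_center q : 'cV[R]_2 :=
  pos q o1 - signed_radius q *: rvec q o1.

Definition residual q i : 'cV[R]_2 :=
  pos q i - rotation_center q - signed_radius q *: rvec q i.

(** The residual of unicycle 1 vanishes identically, and where [rtilde] of [o2] is nonzero that of
    unicycle 2 is determined by [transverse]. Their two slots therefore hold the centre and the pair
    of scalars. *)
Definition plane_part q i : 'cV[R]_2 :=
  match val i with
  | 0%N => rotation_center q
  | 1%N => vec2 (signed_radius q) (transverse q)
  | _ => residual q i
  end.

(* The coordinate of index k < n is the heading of unicycle k and that of index
   n + 2 i + b is component b of plane_part q i, so the coordinates of index
   at least n + 3 are the transverse part and the residuals. *)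
Definition chart q : 'rV[R]_(3 * n) :=
  \row_k match chart_index_of k with
         | inl i => theta q i
         | inr (i, b) => plane_part q i (if b then 1 else 0) 0
         end.

(** Centre plus signed radius times normal plus residual, where the residual of unicycle 2 is
    rebuilt from its transverse component. *)
Definition unchart_pos y i : 'cV[R]_2 :=
  let r j := vec2 (- sin (y 0 (angle_index j))) (cos (y 0 (angle_index j))) in
  let v := plane_coord y o2 in
  plane_coord y o1 + v 0 0 *: r i +
  match val i with
  | 0%N => 0
  | 1%N => - (v 1 0 *: rot_cw (r o1 - r o2))
  | _ => plane_coord y i
  end.

Definition unchart y : 'M[R]_(n, 3) :=
  \matrix_(i, k) if k == 0 then unchart_pos y i 0 0
                 else if k == 1 then unchart_pos y i 1 0
                 else y 0 (angle_index i).

Lemma theta_unchart y i : theta (unchart y) i = y 0 (angle_index i).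
Proof. by rewrite /theta mxE. Qed.

Lemma pos_unchart y i : pos (unchart y) i = unchart_pos y i.
Proof. by apply: cV2P; rewrite !mxE. Qed.

Lemma rvec_unchart y i : rvec (unchart y) i =
  vec2 (- sin (y 0 (angle_index i))) (cos (y 0 (angle_index i))).
Proof. by rewrite /rvec theta_unchart. Qed.

Lemma chart_angle q i : chart q 0 (angle_index i) = theta q i.
Proof. by rewrite mxE chart_index_angle. Qed.

Lemma chart_plane q i : plane_coord (chart q) i = plane_part q i.
Proof. by apply: cV2P; rewrite ?vec20 ?vec21 mxE chart_index_plane. Qed.

(** For unicycle 2 this is the decomposition of [ztilde] along [rtilde], which requires [r0]; for
    the others the terms cancel. *)
Lemma chartK q : rtilde hn q o2 != 0 -> unchart (chart q) = q.
Proof.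
move=> r0; apply: configurationP => i.
  by rewrite theta_unchart chart_angle.
rewrite pos_unchart /unchart_pos !chart_plane !chart_angle -!/(rvec q _).
rewrite [plane_part q o1]/plane_part [plane_part q o2]/plane_part /=.
rewrite vec20 vec21.
case E : (val i) => [|[|k]].
- by rewrite (_ : i = o1); [rewrite addr0 subrK|exact: val_inj].
- rewrite (_ : i = o2); last exact: val_inj.
  have zE : ztilde hn q o2 = signed_radius q *: rtilde hn q o2 +
      transverse q *: rot_cw (rtilde hn q o2) by exact: decompose_along.
  have -> : pos q o2 = pos q o1 - ztilde hn q o2 by rewrite subKr.
  rewrite zE /rotation_center /rtilde; apply: cV2P; rewrite !mxE /=; ring.
- rewrite /plane_part E /residual; apply: cV2P; rewrite !mxE /=; ring.
Qed.

(** In the rebuilt configuration [ztilde] of [o2] is a combination of [rtilde] and its quarter turn.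
    Uniqueness of the coefficients returns the radius and the transverse part, from which the centre
    and the residuals follow. *)
Lemma unchartK y : rtilde hn (unchart y) o2 != 0 -> chart (unchart y) = y.
Proof.
set q := unchart y => r0.
have zE : ztilde hn q o2 = plane_coord y o2 0 0 *: rtilde hn q o2 +
    plane_coord y o2 1 0 *: rot_cw (rtilde hn q o2).
  rewrite /ztilde /rtilde !pos_unchart /unchart_pos /= -!rvec_unchart.
  by apply: cV2P; rewrite !mxE /=; ring.
have lamE : signed_radius q = plane_coord y o2 0 0.
  by rewrite /signed_radius zE coord_along_comb.
have muE : transverse q = plane_coord y o2 1 0.
  by rewrite /transverse zE cross_comb.
have cE : rotation_center q = plane_coord y o1.
  rewrite /rotation_center lamE pos_unchart /unchart_pos /= -!rvec_unchart.
  by rewrite addr0 addrK.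
apply: chart_coordsP => i; first by rewrite chart_angle theta_unchart.
rewrite chart_plane /plane_part; case E : (val i) => [|[|k]].
- by rewrite cE; congr plane_coord; exact: val_inj.
- rewrite lamE muE (_ : i = o2); last exact: val_inj.
  by apply: cV2P; rewrite ?vec20 ?vec21.
- rewrite /residual cE lamE pos_unchart /unchart_pos E -!rvec_unchart.
  by apply: cV2P; rewrite !mxE /=; ring.
Qed.

(** The open conditions contained in the formation equations, isolated so that on this set only the
    equalities remain to be matched with vanishing coordinates. *)
Definition generic_configurations : set 'M[R]_(n, 3) :=
  [set q | forall j, (1 <= j)%N -> rtilde hn q j != 0 /\ ztilde hn q j != 0].

Lemma formation_equations_generic q :
  formation_equations hn q -> generic_configurations q.
Proof.
move=> /formation_equationsP[lam lam0 H] j /H[r0 ->].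
by rewrite r0 scaler_eq0 negb_or lam0 r0.
Qed.

(** By [resE] a residual vanishes exactly when [ztilde] is [signed_radius] times [rtilde], and a
    zero [transverse] says the same for [o2]. Genericity of [ztilde] makes this radius nonzero. *)
Lemma formation_equations_chart q : generic_configurations q ->
  (formation_equations hn q <->
   forall k : 'I_(3 * n), (n + 3 <= k)%N -> chart q 0 k = 0).
Proof.
move=> gen; have [r0 z0] := gen o2 isT.
have resE j : residual q j = signed_radius q *: rtilde hn q j - ztilde hn q j.
  rewrite /residual /rotation_center /rtilde /ztilde.
  by apply: cV2P; rewrite !mxE /=; ring.
split=> [[nz cr ra] k|H].
  case: (chart_indexP k) => [i|i b] /=; first by have := ltn_ord i; lia.
  move=> hk; have -> : chart q 0 (plane_index i b) =
      plane_part q i (if b then 1 else 0) 0 by rewrite mxE chart_index_plane.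
  rewrite /plane_part; case E : (val i) => [|[|m]].
  - by move: hk E; case: b => /=; lia.
  (* The slot of [o2] has indices [n + 2] and [n + 3]: the radius stays free and only [transverse]
     is constrained. *)
  - have -> : b = true by move: hk E; case: b => //=; lia.
    by rewrite vec21 /transverse cr// mul0r.
  - have i2 : (2 <= i)%N by rewrite -[i : nat]/(val i) E.
    rewrite resE; move/subr0_eq: (ra i i2).
    rewrite /formation_ratio -![dot _ _ / _]/(coord_along _ _) => ratioE.
    rewrite /signed_radius ratioE.
    rewrite {2}(decompose_along (ztilde hn q i) (gen i (ltnW i2)).1).
    by rewrite cr ?(ltnW i2)// mul0r scale0r addr0 subrr mxE.
have tr0 : transverse q = 0.
  have := H (plane_index o2 true).
  by rewrite mxE chart_index_plane /plane_part /= vec21; apply; lia.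
have zE : ztilde hn q o2 = signed_radius q *: rtilde hn q o2.
  rewrite {1}(decompose_along (ztilde hn q o2) r0).
  by rewrite -/(transverse q) tr0 scale0r addr0.
apply/formation_equationsP; exists (signed_radius q).
  by apply: contra z0 => /eqP l0; rewrite zE l0 scale0r.
move=> j j1; have [rj0 _] := gen j j1; split=> //.
case: (ltngtP j 1%N) => [|j2|j1']; first by rewrite ltnNge j1.
  apply/esym/subr0_eq; rewrite -resE.
  have E b : residual q j (if b then 1 else 0) 0 = 0.
    have := H (plane_index j b); rewrite mxE chart_index_plane /plane_part.
    case J : (val j) => [|[|m]]; [by move: j2; rewrite -[j : nat]/(val j) J..|].
    by apply=> /=; lia.
  by apply: cV2P; rewrite [RHS]mxE; [exact: (E false)|exact: (E true)].
by rewrite (_ : j = o2)//; exact: val_inj.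
Qed.

End Chart.

(** * Smoothness of the chart *)

Section PlaneValued.
Variables (R : realType) (V : normedModType R) (U : set V) (k : nat).
Hypothesis openU : open U.
Implicit Types (f g : V -> R) (F G : V -> 'cV[R]_2).

(** Stated by components, so that the scalar closure lemmas apply directly. *)
Definition Ck_plane F := forall b, Ck_on k U (fun x => F x b 0).

Lemma Ck_plane_vec2 f g :
  Ck_on k U f -> Ck_on k U g -> Ck_plane (fun x => vec2 (f x) (g x)).
Proof.
move=> Cf Cg b; case: (eqVneq b 0) => b0.
  by apply: (Ck_on_ext openU _ Cf) => x _; rewrite mxE b0.
by apply: (Ck_on_ext openU _ Cg) => x _; rewrite mxE (negbTE b0).
Qed.

Lemma Ck_planeD F G : Ck_plane F -> Ck_plane G -> Ck_plane (fun x => F x + G x).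
Proof.
move=> CF CG b; apply: (Ck_on_ext openU _ (Ck_onD openU (CF b) (CG b))) => x _.
by rewrite mxE.
Qed.

Lemma Ck_planeN F : Ck_plane F -> Ck_plane (fun x => - F x).
Proof.
move=> CF b; apply: (Ck_on_ext openU _ (Ck_onN openU (CF b))) => x _.
by rewrite mxE.
Qed.

Lemma Ck_planeZ f F :
  Ck_on k U f -> Ck_plane F -> Ck_plane (fun x => f x *: F x).
Proof.
move=> Cf CF b; apply: (Ck_on_ext openU _ (Ck_onM openU Cf (CF b))) => x _.
by rewrite mxE.
Qed.

Lemma Ck_plane_rot_cw F : Ck_plane F -> Ck_plane (fun x => rot_cw (F x)).
Proof. by move=> CF; apply: Ck_plane_vec2 => //; exact: Ck_onN. Qed.

Lemma Ck_on_dot F G : Ck_plane F -> Ck_plane G ->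
  Ck_on k U (fun x => dot (F x) (G x)).
Proof.
move=> CF CG; apply: (Ck_on_ext openU (fun x _ => esym (dotE (F x) (G x)))).
by apply: Ck_onD => //; exact: Ck_onM.
Qed.

Lemma Ck_on_cross F G : Ck_plane F -> Ck_plane G ->
  Ck_on k U (fun x => cross (F x) (G x)).
Proof.
move=> CF CG; rewrite /cross.
by apply: Ck_onD => //; [|apply: Ck_onN => //]; exact: Ck_onM.
Qed.

(** The square removes the root in [enorm], leaving a polynomial in the components that is nonzero
    on [U]. *)
Lemma Ck_on_div_sqr_enorm f F : (forall x, U x -> F x != 0) ->
  Ck_on k U f -> Ck_plane F -> Ck_on k U (fun x => f x / enorm (F x) ^+ 2).
Proof.
move=> F0 Cf CF; apply: Ck_onM => //; apply: Ck_onV => //.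
  by move=> x Ux; rewrite sqr_enorm dot_eq0; exact: F0.
apply: (Ck_on_ext openU (fun x _ => esym (sqr_enorm (F x)))).
exact: Ck_on_dot.
Qed.

Lemma Ck_plane_normal f :
  Ck_on k U f -> Ck_plane (fun x => vec2 (- sin (f x)) (cos (f x))).
Proof.
move=> /(Ck_on_sin_cos openU)[Cs Cc]; apply: Ck_plane_vec2 => //.
exact: Ck_onN.
Qed.

End PlaneValued.

Lemma open_plane_neq0 (R : realType) (V : normedModType R) (F : V -> 'cV[R]_2) :
  Ck_plane setT 0 F -> open [set x | F x != 0].
Proof.
move=> CF.
rewrite (_ : mkset _ = (fun x => dot (F x) (F x)) @^-1` [set a | a != 0]).
  apply: open_comp; last exact: open_neq.
  by move=> x _; apply: (Ck_on_dot openT CF CF).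
by apply/seteqP; split=> x /=; rewrite dot_eq0.
Qed.

Lemma open_forall (T : topologicalType) (I : finType) (A : I -> set T) :
  (forall i, open (A i)) -> open [set x | forall i, A i x].
Proof.
move=> oA; rewrite openE => x /= Ax; apply: filter_forall => i.
by apply: open_nbhs_nbhs; split; [exact: oA|exact: Ax].
Qed.

Section ChartIsSmooth.
Variables (R : realType) (n : nat) (hn : (2 <= n)%N).
Implicit Types (q : 'M[R]_(n, 3)) (y : 'rV[R]_(3 * n)) (i j : 'I_n).
Local Notation o1 := (uni1 hn).
Local Notation o2 := (uni2 hn).

Section ConfigurationMaps.
Variables (U : set 'M[R]_(n, 3)) (k : nat).
Hypothesis openU : open U.

Lemma Ck_plane_pos i : Ck_plane U k (fun q => pos q i).
Proof. by apply: Ck_plane_vec2 => //; exact: Ck_on_coord. Qed.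

Lemma Ck_plane_rvec i : Ck_plane U k (fun q => rvec q i).
Proof. by apply: Ck_plane_normal => //; exact: Ck_on_coord. Qed.

Lemma Ck_plane_ztilde j : Ck_plane U k (fun q => ztilde hn q j).
Proof.
by apply: Ck_planeD => //; [|apply: Ck_planeN => //]; exact: Ck_plane_pos.
Qed.

Lemma Ck_plane_rtilde j : Ck_plane U k (fun q => rtilde hn q j).
Proof.
by apply: Ck_planeD => //; [|apply: Ck_planeN => //]; exact: Ck_plane_rvec.
Qed.

Hypothesis U_rtilde : forall q, U q -> rtilde hn q o2 != 0.

Lemma Ck_on_signed_radius : Ck_on k U (signed_radius hn).
Proof.
apply: Ck_on_div_sqr_enorm => //; last exact: Ck_plane_rtilde.
by apply: Ck_on_dot => //; [exact: Ck_plane_ztilde|exact: Ck_plane_rtilde].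
Qed.

Lemma Ck_on_transverse : Ck_on k U (transverse hn).
Proof.
apply: Ck_on_div_sqr_enorm => //; last exact: Ck_plane_rtilde.
by apply: Ck_on_cross => //; [exact: Ck_plane_ztilde|exact: Ck_plane_rtilde].
Qed.

Lemma Ck_plane_rotation_center : Ck_plane U k (rotation_center hn).
Proof.
apply: Ck_planeD => //; first exact: Ck_plane_pos.
apply: Ck_planeN => //; apply: Ck_planeZ => //; last exact: Ck_plane_rvec.
exact: Ck_on_signed_radius.
Qed.

Lemma Ck_plane_residual i : Ck_plane U k (fun q => residual hn q i).
Proof.
apply: Ck_planeD => //.
  apply: Ck_planeD => //; first exact: Ck_plane_pos.
  by apply: Ck_planeN => //; exact: Ck_plane_rotation_center.
apply: Ck_planeN => //; apply: Ck_planeZ => //; last exact: Ck_plane_rvec.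
exact: Ck_on_signed_radius.
Qed.

Lemma Ck_on_chart : Ck_on k U (chart hn).
Proof.
apply: Ck_on_matrix => // a m; rewrite ord1 => {a}.
case: (chart_indexP hn m) => [i|i b].
  apply: (Ck_on_ext openU (fun q _ => esym (chart_angle hn q i))).
  exact: Ck_on_coord.
apply: (@Ck_on_ext _ _ _ _ openU _
    (fun q => plane_part hn q i (if b then 1 else 0) 0)).
  by move=> q _; rewrite mxE chart_index_plane.
rewrite /plane_part; case: (val i) => [|[|_]].
- exact: Ck_plane_rotation_center.
- apply: Ck_plane_vec2 => //; first exact: Ck_on_signed_radius.
  exact: Ck_on_transverse.
- exact: Ck_plane_residual.
Qed.

End ConfigurationMaps.

(** Polynomial in the coordinates and in sines and cosines of angles, hence smooth on every open
    set. *)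
Lemma Ck_plane_unchart_pos (U : set 'rV[R]_(3 * n)) k i : open U ->
  Ck_plane U k (fun y => unchart_pos hn y i).
Proof.
move=> openU.
have Cr j : Ck_plane U k
    (fun y => vec2 (- sin (y 0 (angle_index j))) (cos (y 0 (angle_index j)))).
  by apply: Ck_plane_normal => //; exact: Ck_on_coord.
have Cp j : Ck_plane U k (fun y => plane_coord y j).
  by apply: Ck_plane_vec2 => //; exact: Ck_on_coord.
apply: Ck_planeD => //.
  by apply: Ck_planeD => //; apply: Ck_planeZ => //; exact: Cp.
case: (val i) => [|[|_]] //.
  by move=> b; exact: Ck_on_cst.
apply: Ck_planeN => //; apply: Ck_planeZ => //; first exact: Cp.
by apply: Ck_plane_rot_cw => //; apply: Ck_planeD => //; exact: Ck_planeN.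
Qed.

Lemma Ck_on_unchart (U : set 'rV[R]_(3 * n)) k : open U ->
  Ck_on k U (unchart hn).
Proof.
move=> openU; apply: Ck_on_matrix => // i m.
apply: (@Ck_on_ext _ _ _ _ openU _ (fun y =>
  if m == 0 then unchart_pos hn y i 0 0
  else if m == 1 then unchart_pos hn y i 1 0
  else y 0 (angle_index i))); first by move=> y _; rewrite [RHS]mxE.
case: (m == 0) => /=; first exact: (Ck_plane_unchart_pos k i openU 0).
case: (m == 1) => /=; first exact: (Ck_plane_unchart_pos k i openU 1).
exact: Ck_on_coord.
Qed.

(** * Openness of the domains and nonemptiness of the solution set *)

Lemma open_generic_configurations : open (@generic_configurations R n hn).
Proof.
apply: open_forall => j.
case: (leqP 1 j) => [j1|j0]; last by rewrite (_ : (fun q => _) = setT) //;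
  [exact: openT|apply/seteqP; split].
rewrite (_ : (fun q => _) =
    [set q | rtilde hn q j != 0] `&` [set q | ztilde hn q j != 0]).
  by apply: openI; apply: open_plane_neq0;
    [exact: Ck_plane_rtilde openT _|exact: Ck_plane_ztilde openT _].
by apply/seteqP; split=> q /=; [exact|move=> ? _].
Qed.

Lemma open_no_overlap : open [set q : 'M[R]_(n, 3) | no_overlap q].
Proof.
apply: open_forall => i; apply: open_forall => j.
case: (eqVneq i j) => ij.
  rewrite (_ : (fun q => _) = setT); first exact: openT.
  by apply/seteqP; split.
rewrite (_ : (fun q => _) = [set q | pos q i - pos q j != 0]).
  apply: open_plane_neq0; apply: (Ck_planeD openT).
    exact: Ck_plane_pos openT _.
  by apply: (Ck_planeN openT); exact: Ck_plane_pos openT _.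
by apply/seteqP; split=> q /=; rewrite subr_eq0; [exact|move=> ? _].
Qed.

(** Each unicycle is placed at its own normal on the unit circle about the origin, so [lam = 1]. The
    angles [i / n] lie in the interval from 0 to [pi], where [cos] is injective, so the normals are
    distinct. *)
Lemma formation_equations_no_overlap_nonempty :
  [set q : 'M[R]_(n, 3) | no_overlap q /\ formation_equations hn q] !=set0.
Proof.
pose t i : R := i%:R / n%:R.
have n0 : (0 : R) < n%:R by rewrite ltr0n; lia.
have t_itv i : t i \in `[0, pi].
  rewrite in_itv /= divr_ge0//= (le_trans _ (pi_ge2 R))//.
  rewrite ler_pdivrMr// -natrM ler_nat; have := ltn_ord i; lia.
have t_inj i j : cos (t i) = cos (t j) -> i = j.
  move=> /(cos_inj (t_itv i) (t_itv j)) /(mulIf (invr_neq0 (lt0r_neq0 n0))).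
  by move=> /eqP; rewrite eqr_nat => /eqP; exact: val_inj.
pose q : 'M[R]_(n, 3) := \matrix_(i, k)
  if k == 0 then - sin (t i) else if k == 1 then cos (t i) else t i.
have thE i : theta q i = t i by rewrite /theta mxE.
have posE i : pos q i = rvec q i.
  by apply: cV2P; rewrite /rvec thE ?vec20 ?vec21 mxE.
have r_inj i j : rvec q i = rvec q j -> i = j.
  by move=> /matrixP/(_ 1 0); rewrite !vec21 !thE; exact: t_inj.
exists q; split.
  by move=> i j; apply: contra; rewrite !posE => /eqP/r_inj ->.
apply/formation_equationsP; exists 1; first exact: oner_neq0.
move=> j j1; rewrite scale1r /ztilde !posE; split=> //.
rewrite subr_eq0; apply/negP => /eqP/r_inj E.
by move: j1; rewrite -E.
Qed.

(** The open set [O] allows one argument for both the whole space and the configurations without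
    overlap; one pair of maps serves around every point. *)
Lemma formation_submanifold (O : set 'M[R]_(n, 3)) : open O ->
  [set q | O q /\ formation_equations hn q] !=set0 ->
  submanifold_of_dim (3 * n) (n + 3) [set q | O q /\ formation_equations hn q].
Proof.
move=> openO S0; split=> //; first by lia.
move=> p [Op Ep].
pose U := O `&` generic_configurations hn.
have openU : open U by exact: openI openO open_generic_configurations.
have U_rtilde q : U q -> rtilde hn q (uni2 hn) != 0.
  by move=> [_ /(_ (uni2 hn) isT)[]].
(* With this choice [unchart] maps [V] into [U] by definition, and [chartK] shows that [chart] maps
   [U] into [V]. *)
pose V := unchart hn @^-1` U.
have openV : open V.
  apply: open_comp => // y _.
  by apply: (@Ck_on_unchart setT 0 openT).
exists U, V, (chart hn), (unchart hn); split.
- by split=> //; exact: formation_equations_generic Ep.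
- split=> //.
  + by split=> // q Uq; rewrite /V /= chartK//; exact: U_rtilde.
  + split=> [q Uq|y Vy]; first by rewrite chartK//; exact: U_rtilde.
    by rewrite unchartK//; exact: U_rtilde.
  + split=> k; last exact: Ck_on_unchart.
    exact: Ck_on_chart.
- move=> q [Oq gq]; rewrite -(formation_equations_chart gq).
  by split=> [[]|].
Qed.

End ChartIsSmooth.

Theorem proposition2 (R : realType) (n : nat) (hn : (2 <= n)%N) :
  (forall q : 'M[R]_(n, 3), no_overlap q ->
     (circular_formation q <-> formation_equations hn q)) /\
  submanifold_of_dim (3 * n) (n + 3)
    [set q : 'M[R]_(n, 3) | formation_equations hn q] /\
  submanifold_of_dim (3 * n) (n + 3)
    [set q : 'M[R]_(n, 3) | no_overlap q /\ formation_equations hn q].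
Proof.
split; first by move=> q; exact: circular_formation_iff.
have nonempty := @formation_equations_no_overlap_nonempty R n hn.
split; last first.
  by apply: formation_submanifold => //; exact: open_no_overlap.
rewrite (_ : mkset _ = [set q | setT q /\ formation_equations hn q]).
  apply: formation_submanifold; first exact: openT.
  by have [q [_ Eq]] := nonempty; exists q.
by apply/seteqP; split=> q // [].
Qed.
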